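(* For every hypergraph $H$ having at least two distinct edges with nonempty intersection, it holds that $\mathfrak R(H)\le \mathsf{ex}(H)+1$.
   Context: Hypergraphs $H=(V,E)$ are finite, with $E\subseteq 2^V$, and have no isolated vertices. For a set of sets $X$, $\bigcup X$ is the union of its members ($\bigcup\emptyset=\emptyset$). $\deg_H(v)$ is the number of edges containing $v$. The edge excess of $H$ is $\mathsf{ex}(H):=\max_{e\in E}\sum_{v\in e}\max\{\deg_H(v)-2,0\}$. $\mathbf 1\text{-}\mathsf{Sub}(H)$ is the set of functions $b:2^V\to\mathbb R_{\ge0}$ that are normalised ($b(\emptyset)=0$), monotone, submodular, and satisfy $b(X)\le 1$ for all $e\in E$, $X\subseteq e$. For $F\subseteq E$, $\partial_H(F):=(\bigcup F)\cap(\bigcup(E\setminus F))$ and $\lambda_b(F):=b(\partial_H(F))$. $K^{\mathsf{Sub}}_{\mathbf 1}(H):=\{q\in\mathbb R_{\ge0}^{2^E}: \exists b\in\mathbf 1\text{-}\mathsf{Sub}(H)\text{ with } q\le\lambda_b\text{ pointwise}\}$, and $\gamma_H^{\mathsf{Sub}}(q):=\inf\{\alpha\ge0: q\in\alpha\cdot K^{\mathsf{Sub}}_{\mathbf 1}(H)\}$ ($+\infty$ if no such $\alpha$). The line graph $M=P(H^* )$ has vertex set $E(H)$, with distinct $e,f$ adjacent iff $e\cap f\ne\emptyset$. For $\alpha:E(M)\to\mathbb R_{\ge0}$ and $F\subseteq E(H)$, $q_{M,\alpha}(F):=\sum\{\alpha_{xy}: xy\in E(M), x\in F, y\notin F\}$;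 $\alpha(\mathrm{Inc}_M(e))$ is the sum of $\alpha$ over the edges of $M$ incident with $e$. The submodular gauge-routing ratio is \[ \mathfrak R(H):=\sup_{\alpha\ne0}\frac{\gamma_H^{\mathsf{Sub}}(q_{M,\alpha})}{\max_{e\in E(H)}\alpha(\mathrm{Inc}_M(e))}, \] the supremum being over all nonzero $\alpha:E(M)\to\mathbb R_{\ge0}$. *)

(* Defs.v *)
From HB Require Import structures.
From mathcomp Require Import classical_sets reals ereal.
From mathcomp Require Import all_boot all_order all_algebra.

Set Implicit Arguments.
Unset Strict Implicit.
Unset Printing Implicit Defensive.

Import Order.TTheory GRing.Theory Num.Theory.
Local Open Scope ring_scope.

Record hypergraph (V : finType) := Hypergraph {
  edges :> {set {set V}};
  no_isolated_vertex : cover edges = [set: V]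
}.

Definition deg (V : finType) (H : hypergraph V) (v : V) : nat :=
  #|[set e in edges H | v \in e]|.

(* The subtraction on nat is truncated: it is max {deg v - 2, 0}. *)
Definition edge_excess (V : finType) (H : hypergraph V) : nat :=
  (\max_(e in edges H) \sum_(v in e) (deg H v - 2))%N.

Record one_Sub (R : realType) (V : finType) (H : hypergraph V)
    (b : {set V} -> R) : Prop := OneSub {
  sub_ge0 : forall X, 0 <= b X;
  sub_norm : b set0 = 0;
  sub_mono : forall X Y : {set V}, X \subset Y -> b X <= b Y;
  sub_submod : forall X Y : {set V}, b (X :|: Y) + b (X :&: Y) <= b X + b Y;
  sub_le1 : forall e X : {set V}, e \in edges H -> X \subset e -> b X <= 1
}.

Definition boundary (V : finType) (H : hypergraph V) (F : {set {set V}}) :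
  {set V} := cover F :&: cover (edges H :\: F).

Definition cut_fun (R : realType) (V : finType) (H : hypergraph V)
  (b : {set V} -> R) (F : {set {set V}}) : R := b (boundary H F).

(* A vector indexed by the subsets of E(H) is a function on {set {set V}} of
   which only the values at F \subset edges H are ever used. *)
Definition K_Sub (R : realType) (V : finType) (H : hypergraph V)
    (q : {set {set V}} -> R) : Prop :=
  (forall F : {set {set V}}, F \subset edges H -> 0 <= q F) /\
  exists2 b : {set V} -> R, one_Sub H b &
    forall F : {set {set V}}, F \subset edges H -> q F <= cut_fun H b F.

Definition gauge_Sub (R : realType) (V : finType) (H : hypergraph V)
    (q : {set {set V}} -> R) : \bar R :=
  ereal_inf [set a%:E | a in [set a : R | 0 <= a /\
    exists2 p, K_Sub H p &
      forall F : {set {set V}}, F \subset edges H -> q F = a * p F]]%classic.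

(* The edge xy of the line graph is the two-element set [set x; y]. *)
Definition line_graph (V : finType) (H : hypergraph V) : {set {set {set V}}} :=
  [set [set e; f] | e in edges H, f in edges H & (e != f) && (e :&: f != set0)].

(* A weighting of the line graph is a function of which only the values on
   line_graph H are ever used. *)
Definition cut_weight (R : realType) (V : finType) (H : hypergraph V)
    (alpha : {set {set V}} -> R) (F : {set {set V}}) : R :=
  \sum_(m in line_graph H |
        [exists x in F, exists y in ~: F, m == [set x; y]]) alpha m.

Definition inc_weight (R : realType) (V : finType) (H : hypergraph V)
    (alpha : {set {set V}} -> R) (e : {set V}) : R :=
  \sum_(m in line_graph H | e \in m) alpha m.

(* For a nonnegative alpha and a nonempty edge set, the default value 0 does
   not change the maximum. *)
Definition max_inc_weight (R : realType) (V : finType) (H : hypergraph V)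
    (alpha : {set {set V}} -> R) : R :=
  \big[Num.max/0]_(e in edges H) inc_weight H alpha e.

Definition nonzero_weighting (R : realType) (V : finType) (H : hypergraph V)
    (alpha : {set {set V}} -> R) : Prop :=
  (forall m, m \in line_graph H -> 0 <= alpha m) /\
  exists2 m, m \in line_graph H & alpha m != 0.

Definition routing_ratio (R : realType) (V : finType) (H : hypergraph V) :
    \bar R :=
  ereal_sup [set (gauge_Sub H (cut_weight H alpha)
                  / (max_inc_weight H alpha)%:E)%E
            | alpha in [set alpha : {set {set V}} -> R
                       | nonzero_weighting H alpha]]%classic.

(* Main.v *)
(** Attach each edge [xy] of the line graph to one vertex of [x :&: y].  If [F]
    cuts [xy], that vertex lies on the boundary of [F], so the modular function
    generated by the attached weights dominates the cut function.  An edge [e]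
    of [H] collects at most [M = max_inc_weight H alpha] from line graph edges
    incident with [e]; at a vertex [v] of [e] the others join two of the
    [deg v - 1] other edges through [v], so they weigh at most
    [(deg v - 1) / 2 * M <= (deg v - 2) * M] if [deg v >= 3], and there are none
    if [deg v <= 2]. *)
Require Import Defs.
From mathcomp Require Import classical_sets reals ereal.
From mathcomp Require Import all_boot all_order all_algebra.
From mathcomp Require Import lra.

Set Implicit Arguments.
Unset Strict Implicit.
Unset Printing Implicit Defensive.

Import Order.TTheory GRing.Theory Num.Theory.
Local Open Scope ring_scope.

Lemma line_graphP (V : finType) (H : hypergraph V) (m : {set {set V}}) :
  m \in line_graph H -> exists e f : {set V},
    [/\ e \in edges H, f \in edges H, e != f, e :&: f != set0
      & m = [set e; f]].
Proof.
case/imset2P=> e f eH; rewrite inE => /andP[fH /andP[ef i0]] ->.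
by exists e, f.
Qed.

Lemma line_graph_card (V : finType) (H : hypergraph V) (m : {set {set V}}) :
  m \in line_graph H -> #|m| = 2%N.
Proof. by case/line_graphP=> e [f [_ _ ef _ ->]]; rewrite cards2 ef. Qed.

Lemma line_graph_sub (V : finType) (H : hypergraph V) (m : {set {set V}}) :
  m \in line_graph H -> m \subset edges H.
Proof.
case/line_graphP=> e [f [eH fH _ _ ->]].
by apply/subsetP=> x /set2P[] ->.
Qed.

(** The choice depends on the set [m] alone, so each line graph edge is charged to a single vertex,
    whichever of its two ends is considered. *)
Definition common_vertex (V : finType) (m : {set {set V}}) : option V :=
  [pick v | [forall e in m, v \in e]].

Lemma common_vertex_in (V : finType) (m : {set {set V}}) (v : V) :
  common_vertex m = Some v -> forall e, e \in m -> v \in e.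
Proof.
rewrite /common_vertex; case: pickP => // u /forall_inP um [<-] e.
exact: um.
Qed.

Lemma common_vertex_ex (V : finType) (H : hypergraph V) (m : {set {set V}}) :
  m \in line_graph H -> exists v, common_vertex m = Some v.
Proof.
case/line_graphP=> e [f [_ _ _ /set0Pn[v /setIP[ve vf]] ->]].
rewrite /common_vertex; case: pickP => [u _|/(_ v)/forall_inP[]]; first by exists u.
by move=> x /set2P[] ->.
Qed.

Definition vertex_weight (R : realType) (V : finType) (H : hypergraph V)
    (alpha : {set {set V}} -> R) (v : V) : R :=
  \sum_(m in line_graph H | common_vertex m == Some v) alpha m.

Section NonnegWeighting.
Variables (R : realType) (V : finType) (H : hypergraph V).
Variable alpha : {set {set V}} -> R.
Hypothesis alpha_ge0 : forall m, m \in line_graph H -> 0 <= alpha m.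

Local Notation M := (max_inc_weight H alpha).

Lemma vertex_weight_ge0 (v : V) : 0 <= vertex_weight H alpha v.
Proof. by apply: sumr_ge0 => m /andP[/alpha_ge0]. Qed.

(** After exchanging the sums, each [m] survives for at most one [v], so no weight is counted twice.
    The filter [P] allows restricting to edges incident with a given [e]. *)
Lemma sum_vertex_weight (X : {set V}) (P : pred {set {set V}}) :
  \sum_(v in X) \sum_(m in line_graph H | (common_vertex m == Some v) && P m)
     alpha m
  = \sum_(m in line_graph H | (if common_vertex m is Some v then v \in X
                               else false) && P m) alpha m.
Proof.
under eq_bigr do rewrite big_mkcondr.
rewrite exchange_big [RHS]big_mkcondr /=; apply: eq_bigr => m mL.
have [v mv] := common_vertex_ex mL; rewrite mv.
have [vX|vX] := boolP (v \in X); last first.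
  rewrite big1 // => u uX; case: eqP => // -[vu].
  by rewrite vu uX in vX.
rewrite (bigD1 v) //= eqxx big1 ?addr0 // => u /andP[_ uv].
by case: eqP => // -[vu]; rewrite vu eqxx in uv.
Qed.

Lemma cut_weight_le (F : {set {set V}}) :
  cut_weight H alpha F <= \sum_(v in boundary H F) vertex_weight H alpha v.
Proof.
have -> : \sum_(v in boundary H F) vertex_weight H alpha v =
  \sum_(v in boundary H F)
    \sum_(m in line_graph H | (common_vertex m == Some v) && true) alpha m.
  by apply: eq_bigr => v _; apply: eq_bigl => m; rewrite andbT.
rewrite sum_vertex_weight /cut_weight big_mkcondr [leRHS]big_mkcondr.
apply: ler_sum => m mL; have [v mv] := common_vertex_ex mL.
have am := alpha_ge0 mL; rewrite mv andbT.
case: ifP => [|_]; last by case: ifP.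
case/exists_inP=> x xF /exists_inP[y]; rewrite inE => yF /eqP mE.
(* The cut only gives [y \notin F]; that [y] is an edge of [H], as the boundary requires, comes from
   [m]. *)
have /subsetP mH := line_graph_sub mL.
have [xm ym] : x \in m /\ y \in m by rewrite mE set21 set22.
suff -> : v \in boundary H F by [].
rewrite inE; apply/andP; split; apply/bigcupP.
  by exists x => //; exact: (common_vertex_in mv xm).
exists y; last by exact: (common_vertex_in mv ym).
by rewrite inE yF mH.
Qed.

Lemma inc_weight_le_max (e : {set V}) :
  e \in edges H -> inc_weight H alpha e <= M.
Proof. by move=> eH; apply: (le_bigmax_cond _ (inc_weight H alpha)). Qed.

Lemma max_inc_weight_ge0 : 0 <= M.
Proof. exact: bigmax_ge_id. Qed.

Lemma nonincident_weight_le (e : {set V}) (v : V) :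
  e \in edges H -> v \in e ->
  \sum_(m in line_graph H | (common_vertex m == Some v) && (e \notin m)) alpha m
  <= (deg H v - 2)%:R * M.
Proof.
move=> eH ve; set S := [set f in edges H | v \in f] :\ e.
have eS : e \in [set f in edges H | v \in f] by rewrite inE eH.
have degE : deg H v = #|S|.+1 by rewrite /deg (cardsD1 e) eS.
pose P m := (m \in line_graph H) && ((common_vertex m == Some v) && (e \notin m)).
have PS m : P m -> m \subset S.
  case/and3P=> mL /eqP mv em; apply/subsetP=> f fm.
  rewrite !inE (subsetP (line_graph_sub mL) _ fm).
  rewrite (common_vertex_in mv fm) !andbT.
  by apply: contraNneq em => <-.
rewrite -[leLHS]/(\sum_(m | P m) alpha m) degE.
(* For [#|S| <= 1] the truncated factor is 0, and the sum is empty because [m] would need two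
   elements in [S]. *)
have [S1|S2] := leqP #|S| 1.
  rewrite big_pred0 => [|m]; first by rewrite mulr_ge0 ?ler0n ?max_inc_weight_ge0.
  apply/negP=> Pm; have := subset_leq_card (PS m Pm).
  have /andP[mL _] := Pm; rewrite (line_graph_card mL) => S2.
  by have := leq_trans S2 S1.
(* Double counting: both ends of each [m] lie in [S], and each [f] in [S] sees at most its incident
   weight, hence at most [M]. *)
have double : 2 * (\sum_(m | P m) alpha m) <= #|S|%:R * M.
  have -> : 2 * (\sum_(m | P m) alpha m) =
      \sum_(f in S) \sum_(m | P m && (f \in m)) alpha m.
    under [RHS]eq_bigr do rewrite big_mkcondr.
    rewrite exchange_big /= mulr_sumr; apply: eq_bigr => m Pm.
    have /andP[mL _] := Pm.
    rewrite -big_mkcondr sumr_const mulr_natl; congr (_ *+ _).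
    rewrite -(line_graph_card mL); apply: eq_card => f.
    apply/idP/andP => [fm|[]//]; split=> //.
    exact: (subsetP (PS m Pm)).
  rewrite mulr_natl -sumr_const; apply: ler_sum => f.
  rewrite !inE => /and3P[_ fH _]; apply: le_trans (inc_weight_le_max fH).
  rewrite /inc_weight [leRHS]big_mkcondr [leLHS]big_mkcond.
  rewrite [leRHS]big_mkcond; apply: ler_sum => m _.
  rewrite /P; have [mL|//] := boolP (m \in line_graph H).
  have am := alpha_ge0 mL; case: (f \in m); last by rewrite !andbF.
  by case: ifP.
have M0 := max_inc_weight_ge0.
have c2 : (2 : R) <= #|S|%:R by rewrite ler_nat.
(* With [s = #|S| >= 2], the factor is [s - 1], and [s / 2 <= s - 1]. *)
rewrite subSS natrB ?(ltnW S2) //; nra.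
Qed.

(** The summand 1 pays for the line graph edges incident with [e], each counted at most once over
    all [v] in [e]; the excess pays for the others, vertex by vertex. *)
Lemma edge_vertex_weight_le (e : {set V}) : e \in edges H ->
  \sum_(v in e) vertex_weight H alpha v <= ((edge_excess H)%:R + 1) * M.
Proof.
move=> eH; pose part (b : bool) v :=
  \sum_(m in line_graph H | (common_vertex m == Some v) && ((e \in m) == b))
    alpha m.
have -> : \sum_(v in e) vertex_weight H alpha v =
    \sum_(v in e) part false v + \sum_(v in e) part true v.
  rewrite -big_split; apply: eq_bigr => v _ /=.
  rewrite /vertex_weight (bigID (fun m : {set {set V}} => e \in m)) addrC /=.
  by congr (_ + _); apply: eq_bigl => m; case: (e \in m); rewrite ?andbA ?andbF.
rewrite mulrDl mul1r; apply: lerD; last first.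
  apply: le_trans (inc_weight_le_max eH).
  rewrite sum_vertex_weight /inc_weight [leLHS]big_mkcondr [leRHS]big_mkcondr.
  apply: ler_sum => m mL; have am := alpha_ge0 mL.
  by case: (e \in m); rewrite ?andbF //; case: ifP.
apply: (@le_trans _ _ (\sum_(v in e) (deg H v - 2)%:R * M)).
  apply: ler_sum => v ve; apply: le_trans (nonincident_weight_le eH ve).
  by rewrite le_eqVlt; apply/orP; left; apply/eqP/eq_bigl => m; case: (e \in m).
rewrite -mulr_suml -natr_sum ler_wpM2r ?max_inc_weight_ge0 // ler_nat.
exact: (leq_bigmax_cond (F := fun e : {set V} => (\sum_(v in e) (deg H v - 2))%N)).
Qed.

End NonnegWeighting.

(** Either end of a line graph edge of nonzero weight has positive incident weight. This makes the
    denominator of the routing ratio invertible. *)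
Lemma max_inc_weight_gt0 (R : realType) (V : finType) (H : hypergraph V)
    (alpha : {set {set V}} -> R) :
  nonzero_weighting H alpha -> 0 < max_inc_weight H alpha.
Proof.
case=> a0 [m mL am]; have [e [f [eH _ _ _ mE]]] := line_graphP mL.
apply: lt_le_trans (inc_weight_le_max alpha eH).
rewrite /inc_weight (bigD1 m) /=; last by rewrite mL mE set21.
apply: ltr_pwDl; first by rewrite lt_def am a0.
by apply: sumr_ge0 => k /andP[/andP[/a0]].
Qed.

(** Submodularity holds vertex by vertex, and monotonicity passes the bound from an edge to its
    subsets. *)
Lemma one_Sub_modular (R : realType) (V : finType) (H : hypergraph V)
    (w : V -> R) :
  (forall v, 0 <= w v) ->
  (forall e, e \in edges H -> \sum_(v in e) w v <= 1) ->
  one_Sub H (fun X : {set V} => \sum_(v in X) w v).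
Proof.
move=> w0 w1.
have mono (X Y : {set V}) : X \subset Y -> \sum_(v in X) w v <= \sum_(v in Y) w v.
  move=> XY; rewrite big_mkcond [leRHS]big_mkcond; apply: ler_sum => v _.
  by case: ifP => [/(subsetP XY) ->|_] //; case: ifP.
split=> //.
- by move=> X; apply: sumr_ge0.
- exact: big_set0.
- move=> X Y; rewrite !(big_mkcond (fun v => v \in _)) /= -!big_split.
  apply: ler_sum => v _; rewrite !inE.
  by case: (v \in X); case: (v \in Y); rewrite /= ?addr0 ?add0r.
- by move=> e X /w1 we /mono Xe; apply: le_trans we.
Qed.

(** Membership in [K_Sub] asks only for domination by a cut function, so [q] scaled by [a^-1] is
    itself the required member. *)
Lemma gauge_Sub_le (R : realType) (V : finType) (H : hypergraph V)
    (q : {set {set V}} -> R) (b : {set V} -> R) (a : R) :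
  0 < a -> one_Sub H b ->
  (forall F : {set {set V}}, F \subset edges H -> 0 <= q F) ->
  (forall F : {set {set V}}, F \subset edges H -> q F <= a * cut_fun H b F) ->
  (gauge_Sub H q <= a%:E)%E.
Proof.
move=> a0 bS q0 qb; apply: ereal_inf_lbound; exists a => //; split; first exact: ltW.
exists (fun F => a^-1 * q F) => [|F _]; last by rewrite mulVKf // gt_eqF.
split=> [F FH|]; first by rewrite mulr_ge0 ?invr_ge0 ?(ltW a0) ?q0.
by exists b => // F FH; rewrite mulrC ler_pdivrMr // mulrC qb.
Qed.

Theorem proposition6p4 (R : realType) (V : finType) (H : hypergraph V)
    (hH : exists e f : {set V},
        [/\ e \in edges H, f \in edges H, e != f & e :&: f != set0]) :
  (routing_ratio R H <= ((edge_excess H)%:R + 1)%:E)%E.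
Proof.
apply: ge_ereal_sup => _ [alpha alphaP <-].
have M0 := max_inc_weight_gt0 alphaP; have [alpha0 _] := alphaP.
rewrite inver gt_eqF // lee_pdivrMr // -EFinM; set a := (_ * _).
have a0 : 0 < a by rewrite mulr_gt0 // ltr_wpDl.
(* Here [a] is the claimed bound times the maximal incident weight, which bounds the total vertex
   weight of every edge; scaling by [a^-1] brings these totals down to at most 1. *)
apply: (@gauge_Sub_le _ _ _ _
  (fun X : {set V} => \sum_(v in X) a^-1 * vertex_weight H alpha v)) => //.
- apply: one_Sub_modular => [v|e eH].
    by rewrite mulr_ge0 ?invr_ge0 ?(ltW a0) ?vertex_weight_ge0.
  by rewrite -mulr_sumr mulrC ler_pdivrMr // mul1r edge_vertex_weight_le.
- by move=> F _; apply: sumr_ge0 => m /andP[/alpha0].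
- move=> F _; rewrite /cut_fun -mulr_sumr mulVKf ?gt_eqF //.
  exact: cut_weight_le.
Qed.
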